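(* Let $q\in\mathbb C$ with $0<|q|<1$, let $z\in\mathbb C$, and let $s\in\mathbb C$ be such that $q^{s+j}\ne 1$ for all integers $j\ge 1$. For all $t\in\mathbb C$ small enough (that is, for all $t$ with $|t|<\delta$ for some $\delta>0$), $$\sum_{n=0}^\infty g^{(s)}_n(z;q)\,t^n=\frac{1}{(1-tzq^s)\,(t;q)_{s+1}}.$$
   Context: For $a\in\mathbb C$: $(a;q)_0=1$, $(a;q)_n=(1-a)(1-aq)\cdots(1-aq^{n-1})$ for $n\ge 1$, $(a;q)_\infty=\prod_{i\ge 0}(1-aq^i)$, and for complex $\lambda$, $(a;q)_\lambda=(a;q)_\infty/(aq^\lambda;q)_\infty$ (whenever the denominator is nonzero). Complex powers are principal values, $q^a=\exp(a\,\mathrm{Log}\,q)$. For integers $n\ge 0$, the $q$-Cesàro polynomial is $$g^{(s)}_n(z;q)=\frac{(q^{s+1};q)_n}{(q;q)_n}\;{}_2\phi_1\left(\begin{array}{c} q^{-n},\ q\\ q^{-s-n}\end{array};q,z\right),$$ where $${}_2\phi_1\left(\begin{array}{c} a,\ b\\ c\end{array};q,x\right)=\sum_{k=0}^\infty\frac{(a;q)_k(b;q)_k}{(c;q)_k(q;q)_k}\,x^k;$$ here $(q^{-n};q)_k=0$ for $k>n$, so the series terminates and is understood as the sum over $0\le k\le n$. *)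

(* Defs.v *)
From Stdlib Require Import Reals.
From Coquelicot Require Import Coquelicot.

Open Scope C_scope.

(* Principal argument, with values in (-PI, PI] for z <> 0; the value at 0 is
   irrelevant. *)
Definition Carg (z : C) : R :=
  (if Rlt_dec (Im z) 0 then - acos (Re z / Cmod z)
   else acos (Re z / Cmod z))%R.

Definition Clog (z : C) : C := (ln (Cmod z), Carg z).

Definition Cexp (z : C) : C :=
  ((exp (Re z) * cos (Im z))%R, (exp (Re z) * sin (Im z))%R).

(* The principal value of q ^ a, for q <> 0. *)
Definition Cpower (q a : C) : C := Cexp (a * Clog q).

(* Limit of a complex sequence; meaningful only for convergent sequences. *)
Definition Clim_seq (u : nat -> C) : C :=
  (real (Lim_seq (fun n => Re (u n))), real (Lim_seq (fun n => Im (u n)))).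

Fixpoint qpoch (a q : C) (n : nat) : C :=
  match n with
  | O => 1
  | S m => qpoch a q m * (1 - a * q ^ m)
  end.

Definition qpoch_inf (a q : C) : C := Clim_seq (qpoch a q).

Definition qpoch_cplx (a q lambda : C) : C :=
  qpoch_inf a q / qpoch_inf (a * Cpower q lambda) q.

Definition phi21_term (a b c q x : C) (k : nat) : C :=
  (qpoch a q k * qpoch b q k) / (qpoch c q k * qpoch q q k) * x ^ k.

(* The terminating series 2phi1(a, b; c; q, x) with a = q^(-n): the terms of
   index k > n vanish, and the series is the sum over 0 <= k <= n. *)
Definition phi21_terminating (n : nat) (b c q x : C) : C :=
  sum_n (phi21_term (Cpower q (- INR n)) b c q x) n.

Definition qCesaro (n : nat) (s z q : C) : C :=
  qpoch (Cpower q (s + 1)) q n / qpoch q q n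
  * phi21_terminating n q (Cpower q (- s - INR n)) q z.

(* Main.v *)
Require Import Defs.
From Stdlib Require Import Reals Lra Lia.
From Coquelicot Require Import Coquelicot.
Open Scope C_scope.

(** Put A = q^(s+1) and b_m = (A;q)_m / (q;q)_m.  Two facts give the theorem.

    The q-Cesaro polynomial is a convolution with a geometric sequence.  In its
    k-th term the factors 1 - q^(i-n) of (q^(-n);q)_k equal
    -q^(i-n) (1 - q^(n-i)), and those of (q^(-s-n);q)_k equal
    -q^(-s-n+i) (1 - q^(s+n-i)); the numbers 1 - q^(n-i) and 1 - q^(s+n-i) cancel
    the last k factors of (q;q)_n and (A;q)_n, and each quotient of monomials
    contributes q^s.  Hence g_n is the sum over k <= n of b_(n-k) (z q^s)^k
    ([qCesaro_conv]), and the generating function of the g_n is that of the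
    b_n divided by 1 - t z q^s ([is_series_geom_convolution]).

    The generating function of the b_n is given by the q-binomial theorem
    ([qbinomial]): F(t) = sum_n b_n t^n equals (At;q)_oo / (t;q)_oo, which is
    1 / (t;q)_(s+1).  The recurrence of the b_n says
    (1 - t) F(t) = (1 - A t) F(q t); iterating it N times gives
    (t;q)_N F(t) = (At;q)_N F(q^N t), and F(q^N t) tends to F(0) = 1.

    The same identity with A = 0, where (At;q)_N = 1, also settles the
    infinite products: it shows that (t;q)_N converges and that its limit is
    the inverse of sum_n t^n / (q;q)_n, in particular nonzero, for |t| < 1
    ([qpoch_inf_correct]).

    The radius delta is chosen so that t, A t and t z q^s all have modulus
    below 1. *)

(** * Principal powers *)

Lemma Cexp_plus (a b : C) : Cexp (a + b) = Cexp a * Cexp b.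
Proof.
  unfold Cexp; destruct a as [a1 a2], b as [b1 b2]; simpl.
  rewrite exp_plus, cos_plus, sin_plus.
  unfold Cmult; simpl; f_equal; ring.
Qed.

Lemma Cexp_0 : Cexp 0 = 1.
Proof.
  unfold Cexp; simpl; rewrite exp_0, cos_0, sin_0.
  unfold RtoC; f_equal; ring.
Qed.

(** Polar form: the sign test in the principal argument repairs the sign of
    sin (acos x) = sqrt (1 - x^2), which is |Im z| / |z| at x = Re z / |z|. *)
Lemma Cexp_Clog (z : C) : z <> 0 -> Cexp (Clog z) = z.
Proof.
  intros hz; apply Cmod_gt_0 in hz.
  assert (hle := re_le_Cmod z); apply Rabs_le_between in hle.
  assert (hm : (Cmod z * Cmod z = Re z * Re z + Im z * Im z)%R)
    by (generalize (Cmod2_alt z); simpl; lra).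
  assert (hr : (-1 <= Re z / Cmod z <= 1)%R).
  { split; [apply Rle_div_r | apply Rle_div_l]; lra. }
  assert (hsin : (Cmod z * sqrt (1 - (Re z / Cmod z)²) = Rabs (Im z))%R).
  { replace (1 - (Re z / Cmod z)²)%R with ((Im z / Cmod z)²)%R.
    - rewrite sqrt_Rsqr_abs, Rabs_div by lra.
      rewrite (Rabs_pos_eq (Cmod z)) by lra; field; lra.
    - unfold Rsqr; replace 1%R with (Cmod z * Cmod z / (Cmod z * Cmod z))%R
        by (field; lra).
      rewrite hm at 1; field; lra. }
  transitivity (Re z, Im z); [|symmetry; apply surjective_pairing].
  unfold Cexp, Clog.
  change (Re (ln (Cmod z), Carg z)) with (ln (Cmod z)).
  change (Im (ln (Cmod z), Carg z)) with (Carg z).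
  unfold Carg; rewrite exp_ln by exact hz.
  destruct (Rlt_dec (Im z) 0) as [hi|hi]; f_equal.
  - rewrite cos_neg, cos_acos by exact hr; field; lra.
  - rewrite sin_neg, sin_acos by exact hr.
    rewrite Rabs_left in hsin by exact hi; lra.
  - rewrite cos_acos by exact hr; field; lra.
  - rewrite sin_acos, hsin by exact hr.
    apply Rabs_pos_eq; lra.
Qed.

Lemma Cpower_plus (q a b : C) : Cpower q (a + b) = Cpower q a * Cpower q b.
Proof.
  unfold Cpower; rewrite <- Cexp_plus; f_equal; ring.
Qed.

Lemma Cpower_0 (q : C) : Cpower q 0 = 1.
Proof.
  unfold Cpower; rewrite <- Cexp_0; f_equal; ring.
Qed.

Lemma Cpower_1 (q : C) : q <> 0 -> Cpower q 1 = q.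
Proof.
  intros hq; unfold Cpower; rewrite Cmult_1_l; now apply Cexp_Clog.
Qed.

Lemma Cpower_neq_0 (q a : C) : Cpower q a <> 0.
Proof.
  intros h; apply C1_nz.
  rewrite <- (Cpower_0 q), <- (Cplus_opp_r a), Cpower_plus, h; ring.
Qed.

Lemma Cpower_opp (q a : C) : Cpower q (- a) = / Cpower q a.
Proof.
  assert (h := Cpower_neq_0 q a).
  assert (e : Cpower q a * Cpower q (- a) = 1)
    by now rewrite <- Cpower_plus, Cplus_opp_r, Cpower_0.
  replace (Cpower q (- a)) with (/ Cpower q a * (Cpower q a * Cpower q (- a)))
    by now field.
  rewrite e; ring.
Qed.

Lemma Cpower_INR (q : C) (n : nat) : q <> 0 -> Cpower q (INR n) = q ^ n.
Proof.
  intros hq; induction n as [|n IH]; [apply Cpower_0|].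
  rewrite S_INR, RtoC_plus, Cpower_plus, IH, Cpower_1 by exact hq.
  simpl; ring.
Qed.

(** * Limits of complex sequences *)

(** Convergence in modulus rather than along the neighbourhood filter: the
    topology underlying complex series is that of a product of two lines, whose
    balls are not those of the modulus, and all estimates below bound moduli. *)
Definition Ccvg (u : nat -> C) (l : C) : Prop :=
  is_lim_seq (fun n => Cmod (u n - l)) 0.

Lemma Ccvg_of_le (u : nat -> C) (l : C) (e : nat -> R) :
  (forall n, Cmod (u n - l) <= e n)%R -> is_lim_seq e 0 -> Ccvg u l.
Proof.
  intros h he; unfold Ccvg.
  apply is_lim_seq_le_le with (fun _ => 0%R) e; [|apply is_lim_seq_const|exact he].
  intros n; split; [apply Cmod_ge_0 | apply h].
Qed.

(** The balls of the two topologies contain each other up to a factor sqrt 2. *)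
Lemma is_series_Ccvg (a : nat -> C) (l : C) :
  is_series (K := C_AbsRing) (V := C_NormedModule) a l
  <-> Ccvg (sum_n (G := C_AbelianMonoid) a) l.
Proof.
  unfold is_series, Ccvg; rewrite <- is_lim_seq_spec; split.
  - intros h eps.
    assert (h2 : (0 < sqrt 2)%R) by (apply sqrt_lt_R0; lra).
    assert (h3 : (0 < eps / sqrt 2)%R) by (apply Rdiv_lt_0_compat; [apply eps | exact h2]).
    generalize (proj1 (filterlim_locally (F := eventually) _ _) h (mkposreal _ h3)).
    apply filter_imp; intros n hn; simpl in hn.
    rewrite Rminus_0_r, Rabs_pos_eq by apply Cmod_ge_0.
    generalize (C_NormedModule_mixin_compat2 _ _ (mkposreal _ h3) hn); simpl.
    replace (sqrt 2 * (eps / sqrt 2))%R with (pos eps) by (field; lra).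
    easy.
  - intros h; apply filterlim_locally; intros eps.
    generalize (h eps); apply filter_imp; intros n hn.
    rewrite Rminus_0_r, Rabs_pos_eq in hn by apply Cmod_ge_0.
    now apply C_NormedModule_mixin_compat1.
Qed.

Lemma Ccvg_ext (u v : nat -> C) (l : C) :
  (forall n, u n = v n) -> Ccvg u l -> Ccvg v l.
Proof.
  intros h; apply is_lim_seq_ext; intros n; now rewrite h.
Qed.

Lemma Ccvg_const (l : C) : Ccvg (fun _ => l) l.
Proof.
  apply is_lim_seq_ext with (fun _ => 0%R); [|apply is_lim_seq_const].
  intros _; unfold Cminus; now rewrite Cplus_opp_r, Cmod_0.
Qed.

(** The expansion uv - lm = (u-l)(v-m) + l(v-m) + m(u-l) spares a bound on the
    sequences. *)
Lemma Ccvg_mult (u v : nat -> C) (l m : C) :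
  Ccvg u l -> Ccvg v m -> Ccvg (fun n => u n * v n) (l * m).
Proof.
  intros hu hv.
  apply Ccvg_of_le with (fun n =>
    Cmod (u n - l) * Cmod (v n - m) + Cmod l * Cmod (v n - m)
    + Cmod m * Cmod (u n - l))%R.
  - intros n.
    replace (u n * v n - l * m)
      with ((u n - l) * (v n - m) + l * (v n - m) + m * (u n - l)) by ring.
    rewrite <- !Cmod_mult.
    eapply Rle_trans; [apply Cmod_triangle|].
    apply Rplus_le_compat_r, Cmod_triangle.
  - replace (Finite 0) with (Finite (0 * 0 + Cmod l * 0 + Cmod m * 0))
      by (f_equal; ring).
    apply is_lim_seq_plus'; [apply is_lim_seq_plus'|];
      apply is_lim_seq_mult'; trivial; apply is_lim_seq_const.
Qed.

Lemma Ccvg_unique (u : nat -> C) (l m : C) : Ccvg u l -> Ccvg u m -> l = m.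
Proof.
  intros hl hm.
  assert (h : Ccvg (fun _ => l) m).
  { apply Ccvg_of_le with (fun n => Cmod (u n - l) + Cmod (u n - m))%R.
    - intros n; rewrite <- (Cmod_opp (u n - l)).
      replace (l - m) with (- (u n - l) + (u n - m)) by ring.
      apply Cmod_triangle.
    - replace (Finite 0) with (Finite (0 + 0)) by (f_equal; ring).
      now apply is_lim_seq_plus'. }
  apply is_lim_seq_unique in h; rewrite Lim_seq_const in h.
  injection h as h; apply Cmod_eq_0 in h.
  replace l with (l - m + m) by ring; rewrite h; ring.
Qed.

Lemma is_lim_seq_of_Rabs_le (x : nat -> R) (l : R) (e : nat -> R) :
  (forall n, Rabs (x n - l) <= e n)%R -> is_lim_seq e 0 -> is_lim_seq x l.
Proof.
  intros h he.
  apply is_lim_seq_le_le with (fun n => l - e n)%R (fun n => l + e n)%R.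
  - intros n; generalize (proj1 (Rabs_le_between _ _) (h n)); lra.
  - replace (Finite l) with (Finite (l - 0)) by (f_equal; ring).
    apply is_lim_seq_minus'; [apply is_lim_seq_const | exact he].
  - replace (Finite l) with (Finite (l + 0)) by (f_equal; ring).
    apply is_lim_seq_plus'; [apply is_lim_seq_const | exact he].
Qed.

Lemma Ccvg_Clim_seq (u : nat -> C) (l : C) : Ccvg u l -> Clim_seq u = l.
Proof.
  intros h; unfold Clim_seq; rewrite (surjective_pairing l).
  assert (hmax : forall n, (Rmax (Rabs (Re (u n) - fst l)) (Rabs (Im (u n) - snd l))
                            <= Cmod (u n - l))%R).
  { intros n; exact (Rmax_Cmod (u n - l)). }
  f_equal.
  - rewrite (is_lim_seq_unique _ (fst l)); [reflexivity|].
    apply is_lim_seq_of_Rabs_le with (2 := h).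
    intros n; eapply Rle_trans; [apply Rmax_l | apply hmax].
  - rewrite (is_lim_seq_unique _ (snd l)); [reflexivity|].
    apply is_lim_seq_of_Rabs_le with (2 := h).
    intros n; eapply Rle_trans; [apply Rmax_r | apply hmax].
Qed.

Lemma ex_series_Cmod (a : nat -> C) :
  ex_series (fun n => Cmod (a n)) ->
  is_series (K := C_AbsRing) (V := C_NormedModule) a
    (Clim_seq (sum_n (G := C_AbelianMonoid) a)).
Proof.
  intros h.
  destruct (ex_series_le (K := C_AbsRing) (V := C_CompleteNormedModule) a _
              (fun n => Rle_refl _) h) as [l hl].
  rewrite (Ccvg_Clim_seq _ l); [exact hl|].
  now apply is_series_Ccvg.
Qed.

Lemma Cmod_is_series_le (a : nat -> C) (l : C) (b : nat -> R) :
  is_series (K := C_AbsRing) (V := C_NormedModule) a l ->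
  (forall n, Cmod (a n) <= b n)%R -> ex_series b -> (Cmod l <= Series b)%R.
Proof.
  intros ha hab hb; apply is_series_Ccvg in ha.
  assert (hs : is_lim_seq
     (fun n => Cmod (sum_n (G := C_AbelianMonoid) a n - l) + sum_n b n)%R
     (0 + Series b)%R).
  { apply is_lim_seq_plus'; [exact ha | exact (Series_correct b hb)]. }
  rewrite Rplus_0_l in hs.
  assert (hle : forall n, (Cmod l <=
     Cmod (sum_n (G := C_AbelianMonoid) a n - l) + sum_n b n)%R).
  { intros n.
    apply Rle_trans with (Cmod (sum_n (G := C_AbelianMonoid) a n - l)
                          + Cmod (sum_n (G := C_AbelianMonoid) a n))%R.
    - rewrite <- (Cmod_opp (_ - l)).
      replace l with (- (sum_n (G := C_AbelianMonoid) a n - l)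
                      + sum_n (G := C_AbelianMonoid) a n) at 1 by ring.
      apply Cmod_triangle.
    - apply Rplus_le_compat_l.
      eapply Rle_trans;
        [apply (norm_sum_n_m (K := C_AbsRing) (V := C_NormedModule) a)|].
      apply sum_n_m_le, hab. }
  exact (is_lim_seq_le _ _ _ _ hle (is_lim_seq_const _) hs).
Qed.

(** * The q-binomial series *)

(** The ratio test, comparing with the sequence that satisfies the recurrence
    exactly; unlike u it never vanishes, so its quotients make sense. *)
Lemma ex_series_ratio_le (u rho : nat -> R) (l : R) :
  (forall n, 0 <= u n)%R -> (forall n, 0 < rho n)%R ->
  (forall n, u (S n) <= rho n * u n)%R ->
  is_lim_seq rho l -> (l < 1)%R -> ex_series u.
Proof.
  intros hu hrho hstep hlim hl.
  (* Adding 1 to the initial value keeps the majorant positive if u 0 = 0. *)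
  pose (c := nat_rect (fun _ => R) (u 0%nat + 1)%R (fun n x => rho n * x)%R).
  assert (hc : forall n, (u n <= c n /\ 0 < c n)%R).
  { induction n as [|n [IH1 IH2]]; simpl.
    - generalize (hu 0%nat); lra.
    - split; [|now apply Rmult_lt_0_compat].
      eapply Rle_trans; [apply hstep|].
      apply Rmult_le_compat_l; [apply Rlt_le, hrho | exact IH1]. }
  apply (ex_series_le (K := R_AbsRing) (V := R_CompleteNormedModule) u
           (fun n => Rabs (c n))).
  - intros n; change (Rabs (u n) <= Rabs (c n))%R.
    destruct (hc n) as [h1 h2].
    rewrite !Rabs_pos_eq; [exact h1 | lra | apply hu].
  - apply ex_series_DAlembert with l; [exact hl | |].
    + intros n; generalize (hc n); lra.
    + apply is_lim_seq_ext with rho; [|exact hlim].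
      intros n; simpl; generalize (hc n) (hrho n); intros [_ h1] h2.
      replace (rho n * c n / c n)%R with (rho n) by (field; lra).
      rewrite Rabs_pos_eq; lra.
Qed.

(** The coefficients of the q-binomial series. *)
Definition qbin (A q : C) (n : nat) : C := qpoch A q n / qpoch q q n.

Lemma one_minus_neq_0 (x : C) : (Cmod x < 1)%R -> 1 - x <> 0.
Proof.
  intros hx h.
  assert (e : x = 1) by (replace x with (1 - (1 - x)) by ring; rewrite h; ring).
  rewrite e, Cmod_1 in hx; lra.
Qed.

Lemma Cmod_pow_S_lt_1 (q : C) (n : nat) :
  (Cmod q < 1)%R -> (Cmod (q ^ S n) < 1)%R.
Proof.
  intros hq; rewrite Cmod_pow.
  apply pow_lt_1_compat; [split; [apply Cmod_ge_0 | exact hq] | lia].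
Qed.

Lemma Cinv_neq_0 (x : C) : x <> 0 -> / x <> 0.
Proof.
  intros hx h; apply C1_nz; rewrite <- (Cinv_r x hx), h; ring.
Qed.

Lemma qpoch_neq_0 (a q : C) (n : nat) :
  (forall i, (i < n)%nat -> 1 - a * q ^ i <> 0) -> qpoch a q n <> 0.
Proof.
  induction n as [|n IH]; intros h; simpl; [apply C1_nz|].
  apply Cmult_neq_0; [apply IH; intros i hi|]; apply h; lia.
Qed.

Lemma qpoch_q_neq_0 (q : C) (n : nat) : (Cmod q < 1)%R -> qpoch q q n <> 0.
Proof.
  intros hq; apply qpoch_neq_0; intros i _.
  now apply one_minus_neq_0, (Cmod_pow_S_lt_1 q i).
Qed.

Lemma qbin_0 (A q : C) : qbin A q 0 = 1.
Proof. unfold qbin; simpl; field; apply C1_nz. Qed.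

Lemma qbin_S (A q : C) (n : nat) : (Cmod q < 1)%R ->
  qbin A q (S n) = (1 - A * q ^ n) / (1 - q ^ S n) * qbin A q n.
Proof.
  intros hq; unfold qbin; simpl.
  assert (h1 := qpoch_q_neq_0 q n hq).
  assert (h2 := one_minus_neq_0 _ (Cmod_pow_S_lt_1 q n hq)); simpl in h2.
  field; split; assumption.
Qed.

(** The ratio of consecutive coefficients has modulus at most
    (1 + |A||q|^n) / (1 - |q|^(n+1)), which tends to 1. *)
Lemma qbin_series_abs (A q : C) (r : R) :
  (Cmod q < 1)%R -> (0 <= r < 1)%R ->
  ex_series (fun n => Cmod (qbin A q n) * r ^ n)%R.
Proof.
  intros hq hr.
  assert (hq0 := Cmod_ge_0 q); assert (hA := Cmod_ge_0 A).
  (* Any number in [r, 1) that is positive even for r = 0 would do: the ratios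
     in the comparison must not vanish. *)
  pose (R0 := ((1 + r) / 2)%R).
  assert (hpow : is_lim_seq (fun n => Cmod q ^ n)%R 0)
    by (apply is_lim_seq_geom; rewrite Rabs_pos_eq; assumption).
  assert (hpos : forall n, (0 < 1 - Cmod q ^ S n)%R).
  { intros n; generalize (Cmod_pow_S_lt_1 q n hq); rewrite Cmod_pow; lra. }
  apply ex_series_ratio_le with
    (rho := fun n => ((1 + Cmod A * Cmod q ^ n) / (1 - Cmod q ^ S n) * R0)%R)
    (l := R0).
  - intros n; apply Rmult_le_pos; [apply Cmod_ge_0 | apply pow_le, hr].
  - intros n; apply Rmult_lt_0_compat; [|unfold R0; lra].
    apply Rdiv_lt_0_compat; [|apply hpos].
    generalize (Rmult_le_pos _ _ hA (pow_le _ n hq0)); lra.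
  - intros n; rewrite qbin_S, Cmod_mult by exact hq.
    rewrite Cmod_div by now apply one_minus_neq_0, Cmod_pow_S_lt_1.
    assert (h1 : (Cmod (1 - A * q ^ n) <= 1 + Cmod A * Cmod q ^ n)%R).
    { eapply Rle_trans; [apply Cmod_triangle|].
      rewrite Cmod_opp, Cmod_1, Cmod_mult, Cmod_pow; lra. }
    assert (h2 : (1 - Cmod q ^ S n <= Cmod (1 - q ^ S n))%R).
    { rewrite <- Cmod_pow, <- Cmod_1.
      replace (Cmod 1) with (Cmod ((1 - q ^ S n) + q ^ S n)) at 1
        by (f_equal; ring).
      generalize (Cmod_triangle (1 - q ^ S n) (q ^ S n)); rewrite Cmod_1; lra. }
    assert (h3 : (Cmod (1 - A * q ^ n) / Cmod (1 - q ^ S n)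
                  <= (1 + Cmod A * Cmod q ^ n) / (1 - Cmod q ^ S n))%R).
    { apply Rmult_le_compat; [apply Cmod_ge_0 | | exact h1 |].
      - apply Rlt_le, Rinv_0_lt_compat; generalize (hpos n); lra.
      - apply Rinv_le_contravar; [apply hpos | exact h2]. }
    assert (h4 : (r <= R0)%R) by (unfold R0; lra).
    assert (h5 : (0 <= Cmod (1 - A * q ^ n) / Cmod (1 - q ^ S n))%R).
    { apply Rmult_le_pos; [apply Cmod_ge_0|].
      apply Rlt_le, Rinv_0_lt_compat; generalize (hpos n); lra. }
    replace (_ * Cmod (qbin A q n) * r ^ S n)%R
      with ((Cmod (1 - A * q ^ n) / Cmod (1 - q ^ S n) * r)
            * (Cmod (qbin A q n) * r ^ n))%R by (simpl; ring).
    apply Rmult_le_compat_r;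
      [apply Rmult_le_pos; [apply Cmod_ge_0 | apply pow_le, hr]|].
    apply Rmult_le_compat; [exact h5 | apply hr | exact h3 | exact h4].
  - replace (Finite R0) with (Finite ((1 + Cmod A * 0) / (1 - 0) * R0))
      by (f_equal; field).
    apply is_lim_seq_mult'; [|apply is_lim_seq_const].
    apply is_lim_seq_div'; [| | lra].
    + apply is_lim_seq_plus'; [apply is_lim_seq_const|].
      apply is_lim_seq_mult'; [apply is_lim_seq_const | exact hpow].
    + apply is_lim_seq_minus'; [apply is_lim_seq_const|].
      now apply is_lim_seq_incr_1 in hpow.
  - unfold R0; lra.
Qed.

Definition qbin_sum (A q t : C) : C :=
  Clim_seq (sum_n (G := C_AbelianMonoid) (fun n => qbin A q n * t ^ n)).

Lemma qbin_sum_correct (A q t : C) : (Cmod q < 1)%R -> (Cmod t < 1)%R ->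
  is_series (K := C_AbsRing) (V := C_NormedModule)
    (fun n => qbin A q n * t ^ n) (qbin_sum A q t).
Proof.
  intros hq ht; apply ex_series_Cmod.
  eapply ex_series_ext;
    [|apply (qbin_series_abs A q (Cmod t) hq); split; [apply Cmod_ge_0 | exact ht]].
  intros n; simpl; now rewrite Cmod_mult, Cmod_pow.
Qed.

Lemma is_series_Cunique (a : nat -> C) (l m : C) :
  is_series (K := C_AbsRing) (V := C_NormedModule) a l ->
  is_series (K := C_AbsRing) (V := C_NormedModule) a m -> l = m.
Proof.
  intros hl hm; apply is_series_Ccvg in hl; apply is_series_Ccvg in hm.
  exact (Ccvg_unique _ _ _ hl hm).
Qed.

Lemma Cmod_mult_lt_1 (x y : C) :
  (Cmod x <= 1)%R -> (Cmod y < 1)%R -> (Cmod (x * y) < 1)%R.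
Proof.
  intros hx hy; rewrite Cmod_mult.
  apply Rle_lt_trans with (1 * Cmod y)%R; [|lra].
  apply Rmult_le_compat_r; [apply Cmod_ge_0 | exact hx].
Qed.

(** The recurrence b_(n+1) (1 - q^(n+1)) = b_n (1 - A q^n), multiplied by t^(n+1)
    and summed, reads F(t) - F(qt) = t (F(t) - A F(qt)). *)
Lemma qbin_sum_functional (A q t : C) : (Cmod q < 1)%R -> (Cmod t < 1)%R ->
  (1 - t) * qbin_sum A q t = (1 - A * t) * qbin_sum A q (q * t).
Proof.
  intros hq ht.
  assert (h1 := qbin_sum_correct A q t hq ht).
  assert (h2 := qbin_sum_correct A q (q * t) hq
                  (Cmod_mult_lt_1 _ _ (Rlt_le _ _ hq) ht)).
  set (F := qbin_sum A q t) in *; set (G := qbin_sum A q (q * t)) in *.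
  assert (h3 := is_series_minus _ _ _ _ h1 h2).
  assert (h4 := is_series_scal t _ _ (is_series_minus _ _ _ _ h1
                  (is_series_scal A _ _ h2))).
  assert (e : F - G = t * (F - A * G)).
  (* The term of index 0 of F - G vanishes, so its series can be shifted. *)
  { apply is_series_Cunique with (2 := h4).
    eapply is_series_ext; [|apply is_series_incr_1].
    2: { match goal with |- is_series _ ?x => replace x with (F - G) end.
         - exact h3.
         - rewrite <- (Cplus_0_r (F - G)) at 1.
           apply (f_equal (Cplus (F - G))).
           change (RtoC 0 = qbin A q 0 * t ^ 0 - qbin A q 0 * (q * t) ^ 0).
           simpl; ring. }
    intros n.
    change (qbin A q (S n) * t ^ S n - qbin A q (S n) * (q * t) ^ S n
            = t * (qbin A q n * t ^ n - A * (qbin A q n * (q * t) ^ n))).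
    rewrite qbin_S, !Cpow_mult_l, !Cpow_S by exact hq.
    field.
    now apply (one_minus_neq_0 _ (Cmod_pow_S_lt_1 q n hq)). }
  replace ((1 - t) * F) with (F - G + G - t * F) by ring.
  rewrite e; ring.
Qed.

Lemma Cmod_pow_le_1 (q : C) (n : nat) : (Cmod q < 1)%R -> (Cmod (q ^ n) <= 1)%R.
Proof.
  intros hq; destruct n as [|n]; [simpl; rewrite Cmod_1; lra|].
  now apply Rlt_le, Cmod_pow_S_lt_1.
Qed.

Lemma qbin_sum_iterate (A q t : C) (N : nat) :
  (Cmod q < 1)%R -> (Cmod t < 1)%R ->
  qpoch t q N * qbin_sum A q t = qpoch (A * t) q N * qbin_sum A q (q ^ N * t).
Proof.
  intros hq ht; induction N as [|N IH].
  - simpl; now rewrite !Cmult_1_l.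
  - assert (h := qbin_sum_functional A q (q ^ N * t) hq
                   (Cmod_mult_lt_1 _ _ (Cmod_pow_le_1 q N hq) ht)).
    simpl qpoch.
    replace (q ^ S N * t) with (q * (q ^ N * t)) by (rewrite Cpow_S; ring).
    replace (qpoch t q N * (1 - t * q ^ N) * qbin_sum A q t)
      with ((1 - q ^ N * t) * (qpoch t q N * qbin_sum A q t)) by ring.
    rewrite IH.
    replace ((1 - q ^ N * t) * (qpoch (A * t) q N * qbin_sum A q (q ^ N * t)))
      with (qpoch (A * t) q N * ((1 - q ^ N * t) * qbin_sum A q (q ^ N * t)))
      by ring.
    rewrite h; ring.
Qed.

(** Continuity at 0, in the quantitative form F(u) = 1 + O(u). *)
Lemma qbin_sum_near_0 (A q : C) (r : R) : (Cmod q < 1)%R -> (0 <= r < 1)%R ->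
  exists K : R, forall u : C, (Cmod u <= r)%R ->
    (Cmod (qbin_sum A q u - 1) <= Cmod u * K)%R.
Proof.
  intros hq hr.
  pose (b := fun n => (Cmod (qbin A q n) * r ^ n)%R).
  assert (hb : ex_series (fun n => Cmod (qbin A q (S n)) * r ^ n)%R).
  { destruct (Req_dec r 0) as [h0|h0].
    (* For r = 0 the series has a single nonzero term, as 0 ^ 0 = 1. *)
    - subst r; exists (Cmod (qbin A q 1)).
      apply (is_series_decr_1 (V := R_NormedModule)).
      apply (is_series_ext (fun _ => 0%R)).
      + intros n; simpl; ring.
      + match goal with |- is_series _ ?x => replace x with 0%R end.
        * apply filterlim_ext with (fun _ => 0%R); [|apply filterlim_const].
          intros n; rewrite sum_n_const; ring.
        * unfold plus, opp; simpl; ring.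
    - apply ex_series_ext with (fun n => (/ r * b (S n)))%R.
      + intros n; unfold b; simpl; field; exact h0.
      + apply (ex_series_scal (K := R_AbsRing) (V := R_NormedModule)
               (/ r)%R (fun n => b (S n))).
        apply -> (ex_series_incr_1 b).
        now apply qbin_series_abs. }
  exists (Series (fun n => Cmod (qbin A q (S n)) * r ^ n)%R); intros u hu.
  rewrite <- Series_scal_l.
  apply Cmod_is_series_le with (fun n => qbin A q (S n) * u ^ S n).
  - apply (is_series_incr_1 (fun n => qbin A q n * u ^ n)).
    match goal with |- is_series _ ?x => replace x with (qbin_sum A q u) end.
    + apply qbin_sum_correct; lra.
    + change (qbin_sum A q u = qbin_sum A q u - 1 + qbin A q 0 * u ^ 0).
      rewrite qbin_0; simpl; ring.
  - intros n; rewrite Cmod_mult, Cmod_pow; simpl.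
    replace (Cmod (qbin A q (S n)) * (Cmod u * Cmod u ^ n))%R
      with (Cmod u * (Cmod (qbin A q (S n)) * Cmod u ^ n))%R by ring.
    apply Rmult_le_compat_l; [apply Cmod_ge_0|].
    apply Rmult_le_compat_l; [apply Cmod_ge_0|].
    apply pow_incr; split; [apply Cmod_ge_0 | exact hu].
  - apply (ex_series_scal (K := R_AbsRing) (V := R_NormedModule) (Cmod u) _ hb).
Qed.

Lemma qbin_sum_dilate_lim (A q t : C) : (Cmod q < 1)%R -> (Cmod t < 1)%R ->
  Ccvg (fun N => qbin_sum A q (q ^ N * t)) 1.
Proof.
  intros hq ht.
  destruct (qbin_sum_near_0 A q (Cmod t) hq) as [K hK];
    [split; [apply Cmod_ge_0 | exact ht]|].
  apply Ccvg_of_le with (fun N => Cmod q ^ N * (Cmod t * K))%R.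
  - intros N; rewrite <- Rmult_assoc, <- Cmod_pow, <- Cmod_mult.
    apply hK; rewrite Cmod_mult.
    rewrite <- (Rmult_1_l (Cmod t)) at 2.
    apply Rmult_le_compat_r; [apply Cmod_ge_0 | now apply Cmod_pow_le_1].
  - replace (Finite 0) with (Finite (0 * (Cmod t * K))) by (f_equal; ring).
    apply is_lim_seq_mult'; [|apply is_lim_seq_const].
    apply is_lim_seq_geom; rewrite Rabs_pos_eq; [exact hq | apply Cmod_ge_0].
Qed.

(** Convergence and nonvanishing of the infinite product come from the series
    E = [qbin_sum 0 q]: since (a;q)_N E(a) = E(q^N a) tends to 1, E(a) cannot be
    0, and (a;q)_N tends to 1 / E(a). *)
Lemma qpoch_inf_correct (a q : C) : (Cmod q < 1)%R -> (Cmod a < 1)%R ->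
  Ccvg (qpoch a q) (qpoch_inf a q) /\ qpoch_inf a q <> 0.
Proof.
  intros hq ha.
  assert (hlim := qbin_sum_dilate_lim 0 q a hq ha).
  assert (hit : forall N, qpoch a q N * qbin_sum 0 q a = qbin_sum 0 q (q ^ N * a)).
  { intros N; rewrite qbin_sum_iterate by assumption.
    replace (qpoch (0 * a) q N) with (RtoC 1); [ring|].
    induction N as [|N IH]; simpl; [reflexivity | rewrite <- IH; ring]. }
  assert (hE : qbin_sum 0 q a <> 0).
  { intros h; apply C1_nz, (Ccvg_unique _ _ _ hlim).
    apply Ccvg_ext with (fun _ => 0); [|apply Ccvg_const].
    intros N; rewrite <- hit, h; ring. }
  assert (hc : Ccvg (qpoch a q) (1 * / qbin_sum 0 q a)).
  { apply Ccvg_ext with (fun N => qbin_sum 0 q (q ^ N * a) * / qbin_sum 0 q a).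
    - intros N; rewrite <- hit; field; exact hE.
    - apply Ccvg_mult; [exact hlim | apply Ccvg_const]. }
  unfold qpoch_inf; rewrite (Ccvg_Clim_seq _ _ hc).
  split; [exact hc|].
  rewrite Cmult_1_l; now apply Cinv_neq_0.
Qed.

(** Let N tend to infinity in [qbin_sum_iterate]. *)
Lemma qbinomial (A q t : C) :
  (Cmod q < 1)%R -> (Cmod t < 1)%R -> (Cmod (A * t) < 1)%R ->
  is_series (K := C_AbsRing) (V := C_NormedModule)
    (fun n => qbin A q n * t ^ n) (qpoch_inf (A * t) q / qpoch_inf t q).
Proof.
  intros hq ht hAt.
  destruct (qpoch_inf_correct t q hq ht) as [h1 h0].
  destruct (qpoch_inf_correct (A * t) q hq hAt) as [h2 _].
  replace (qpoch_inf (A * t) q / qpoch_inf t q) with (qbin_sum A q t);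
    [now apply qbin_sum_correct|].
  assert (e : qpoch_inf t q * qbin_sum A q t = qpoch_inf (A * t) q * 1).
  { apply (Ccvg_unique (fun N => qpoch t q N * qbin_sum A q t)).
    - apply Ccvg_mult; [exact h1 | apply Ccvg_const].
    - apply Ccvg_ext with
        (fun N => qpoch (A * t) q N * qbin_sum A q (q ^ N * t)).
      + intros N; symmetry; now apply qbin_sum_iterate.
      + apply Ccvg_mult; [exact h2 | now apply qbin_sum_dilate_lim]. }
  rewrite Cmult_1_r in e; rewrite <- e; field; exact h0.
Qed.

(** * Convolution with a geometric sequence *)

(** Once d is below (eps/2)(1 - r), the excess of x over eps/2 shrinks at least
    by the factor r at each step. *)
Lemma contraction_lim_0 (x d : nat -> R) (r : R) :
  (0 <= r < 1)%R -> (forall n, 0 <= x n)%R ->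
  (forall n, x (S n) <= r * x n + d n)%R ->
  is_lim_seq d 0 -> is_lim_seq x 0.
Proof.
  intros hr hx hstep hd.
  apply is_lim_seq_spec; intros eps; simpl.
  assert (heps := cond_pos eps).
  assert (he : (0 < eps / 2 * (1 - r))%R) by (apply Rmult_lt_0_compat; lra).
  apply is_lim_seq_spec in hd.
  destruct (hd (mkposreal _ he)) as [N hN]; simpl in hN.
  assert (hk : forall k, (x (N + k)%nat <= r ^ k * x N + eps / 2)%R).
  { induction k as [|k IH].
    - rewrite Nat.add_0_r; simpl; lra.
    - rewrite Nat.add_succ_r; eapply Rle_trans; [apply hstep|].
      assert (hdk := hN (N + k)%nat ltac:(lia)).
      rewrite Rminus_0_r in hdk; apply Rabs_lt_between in hdk.
      apply Rmult_le_compat_l with (r := r) in IH; [|apply hr].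
      simpl; lra. }
  assert (hg : is_lim_seq (fun k => r ^ k * x N)%R 0).
  { replace (Finite 0) with (Finite (0 * x N)) by (f_equal; ring).
    apply is_lim_seq_mult'; [|apply is_lim_seq_const].
    apply is_lim_seq_geom; rewrite Rabs_pos_eq; lra. }
  apply is_lim_seq_spec in hg.
  destruct (hg (mkposreal _ (is_pos_div_2 eps))) as [M hM]; simpl in hM.
  exists (N + M)%nat; intros n hn.
  replace n with (N + (n - N))%nat by lia.
  assert (h1 := hM (n - N)%nat ltac:(lia)).
  rewrite Rminus_0_r in *; apply Rabs_lt_between in h1.
  rewrite Rabs_pos_eq by apply hx.
  generalize (hk (n - N)%nat); lra.
Qed.

(** The partial sums S of the convolution and those B of the series satisfy S_(n+1) = B_(n+1) + w S_n, whose
    fixed point for B = l is l / (1 - w). *)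
Lemma is_series_geom_convolution (a : nat -> C) (l w : C) :
  is_series (K := C_AbsRing) (V := C_NormedModule) a l -> (Cmod w < 1)%R ->
  is_series (K := C_AbsRing) (V := C_NormedModule)
    (fun n => sum_n (G := C_AbelianMonoid) (fun k => a (n - k)%nat * w ^ k) n)
    (l / (1 - w)).
Proof.
  intros ha hw.
  assert (hw1 := one_minus_neq_0 w hw).
  set (c := fun n => sum_n (G := C_AbelianMonoid) (fun k => a (n - k)%nat * w ^ k) n).
  assert (hc : forall n, c (S n) = a (S n) + w * c n).
  { intros n; unfold c, sum_n at 1.
    rewrite sum_Sn_m by lia.
    rewrite <- sum_n_m_S.
    change plus with Cplus; f_equal.
    - rewrite Nat.sub_0_r; simpl; ring.
    - rewrite <- (sum_n_mult_l (K := C_Ring) w).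
      apply sum_n_ext; intros k; simpl.
      change mult with Cmult; ring. }
  assert (hc0 : c 0%nat = a 0%nat)
    by (unfold c; rewrite sum_O; simpl; apply Cmult_1_r).
  apply is_series_Ccvg in ha; apply is_series_Ccvg.
  assert (hS : forall n, sum_n (G := C_AbelianMonoid) c (S n)
     = sum_n (G := C_AbelianMonoid) a (S n) + w * sum_n (G := C_AbelianMonoid) c n).
  { induction n as [|n IH].
    - rewrite !sum_Sn, !sum_O, hc, hc0.
      change (a 0%nat + (a 1%nat + w * a 0%nat) = a 0%nat + a 1%nat + w * a 0%nat).
      ring.
    - rewrite sum_Sn, IH at 1; rewrite (sum_Sn a (S n)), (sum_Sn c n), (hc (S n)).
      set (x := sum_n a (S n)); set (y := sum_n c n).
      change (x + w * y + (a (S (S n)) + w * c (S n))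
              = x + a (S (S n)) + w * (y + c (S n))); ring. }
  apply contraction_lim_0 with
    (d := fun n => Cmod (sum_n (G := C_AbelianMonoid) a (S n) - l)) (r := Cmod w).
  - split; [apply Cmod_ge_0 | exact hw].
  - intros n; apply Cmod_ge_0.
  - intros n; rewrite hS.
    replace (sum_n (G := C_AbelianMonoid) a (S n)
             + w * sum_n (G := C_AbelianMonoid) c n - l / (1 - w))
      with (w * (sum_n (G := C_AbelianMonoid) c n - l / (1 - w))
            + (sum_n (G := C_AbelianMonoid) a (S n) - l)) by (field; exact hw1).
    rewrite <- Cmod_mult; apply Cmod_triangle.
  - now apply is_lim_seq_incr_1 in ha.
Qed.

(** * The q-Cesaro polynomials *)

(** The k-th coefficient of the q-Cesaro polynomial, with sigma = q^s.  Going from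
    k to k+1 multiplies the left-hand side by
    (1 - q^(-m-1)) / (1 - sigma^(-1) q^(-m-1)), where m + 1 = n - k, which is
    sigma (1 - q^(m+1)) / (1 - sigma q^(m+1)): the factor sigma times the inverse
    of the factor by which [qbin (sigma * q) q] grows from m to m+1. *)
Lemma qCesaro_term_ratio (q sigma : C) (n k : nat) :
  (0 < Cmod q < 1)%R -> sigma <> 0 ->
  (forall j, (1 <= j)%nat -> sigma * q ^ j <> 1) -> (k <= n)%nat ->
  qpoch (/ (sigma * q ^ n)) q k <> 0 /\
  qpoch (sigma * q) q n / qpoch q q n
  * (qpoch (/ q ^ n) q k / qpoch (/ (sigma * q ^ n)) q k)
  = qbin (sigma * q) q (n - k) * sigma ^ k.
Proof.
  intros hq hsigma hs.
  assert (hq0 : q <> 0) by (apply Cmod_gt_0; lra).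
  assert (hfac : forall j, (1 <= j)%nat -> 1 - sigma * q ^ j <> 0).
  { intros j hj h; apply (hs j hj).
    replace (sigma * q ^ j) with (1 - (1 - sigma * q ^ j)) by ring.
    rewrite h; ring. }
  induction k as [|k IH]; intros hk.
  - split; [apply C1_nz|].
    rewrite Nat.sub_0_r; unfold qbin; simpl.
    field; apply qpoch_q_neq_0; lra.
  - destruct IH as [IH1 IH2]; [lia|].
    destruct (Nat.le_exists_sub (S k) n hk) as [m [hm _]].
    replace (n - k)%nat with (S m) in IH2 by lia.
    replace (n - S k)%nat with m by lia.
    assert (hm1 := one_minus_neq_0 _ (Cmod_pow_S_lt_1 q m (proj2 hq))).
    assert (hm2 := hfac (S m) ltac:(lia)).
    rewrite qbin_S in IH2 by lra.
    assert (hqn : q ^ n = q ^ S m * q ^ k) by (rewrite <- Cpow_add_r; f_equal; lia).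
    assert (hqk := Cpow_nz q k hq0); assert (hqm := Cpow_nz q (S m) hq0).
    assert (e1 : 1 - / q ^ n * q ^ k = - (1 - q ^ S m) / q ^ S m).
    { rewrite hqn; field; split; assumption. }
    assert (e2 : 1 - / (sigma * q ^ n) * q ^ k
                 = - (1 - sigma * q ^ S m) / (sigma * q ^ S m)).
    { rewrite hqn; field; repeat split; assumption. }
    assert (hn0 : 1 - / (sigma * q ^ n) * q ^ k <> 0).
    { rewrite e2; apply Cmult_neq_0.
      - intros h; apply hm2.
        replace (1 - sigma * q ^ S m) with (- - (1 - sigma * q ^ S m)) by ring.
        rewrite h; ring.
      - now apply Cinv_neq_0, Cmult_neq_0. }
    split; [simpl; now apply Cmult_neq_0|].
    simpl qpoch.
    assert (hfrac : forall p x c u v : C, c <> 0 -> v <> 0 ->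
      p * (x * u / (c * v)) = u / v * (p * (x / c))) by (intros; now field).
    rewrite hfrac by assumption.
    rewrite IH2, e1, e2.
    replace (sigma * q * q ^ m) with (sigma * q ^ S m) by (simpl; ring).
    rewrite (Cpow_S sigma k); field.
    repeat split; assumption.
Qed.

Lemma qCesaro_conv (n : nat) (s z q : C) :
  (0 < Cmod q < 1)%R ->
  (forall j : nat, (1 <= j)%nat -> Cpower q (s + INR j) <> 1) ->
  qCesaro n s z q =
  sum_n (G := C_AbelianMonoid)
    (fun k => qbin (Cpower q (s + 1)) q (n - k) * (z * Cpower q s) ^ k) n.
Proof.
  intros hq hs.
  assert (hq0 : q <> 0) by (apply Cmod_gt_0; lra).
  assert (hsigma := Cpower_neq_0 q s).
  unfold qCesaro, phi21_terminating.
  change Cmult with (@mult C_Ring).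
  rewrite <- (sum_n_mult_l (K := C_Ring)).
  apply sum_n_ext_loc; intros k hk.
  change (@mult C_Ring) with Cmult.
  unfold phi21_term.
  rewrite Cpower_plus, Cpower_1 by exact hq0.
  replace (- s - INR n) with (- (s + INR n)) by ring.
  rewrite !Cpower_opp, Cpower_plus, Cpower_INR by exact hq0.
  destruct (qCesaro_term_ratio q (Cpower q s) n k) as [h0 h]; try assumption.
  { intros j hj; rewrite <- Cpower_INR, <- Cpower_plus by exact hq0.
    now apply hs. }
  rewrite Cpow_mult_l.
  replace (qbin _ q _ * (z ^ k * Cpower q s ^ k))
    with (qbin (Cpower q s * q) q (n - k) * Cpower q s ^ k * z ^ k) by ring.
  rewrite <- h.
  match goal with |- ?x = ?y => change (@eq C x y) end; field.
  repeat split; try apply qpoch_q_neq_0; try lra; assumption.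
Qed.

Theorem theorem3p6 (q z s : C)
  (hq0 : (0 < Cmod q)%R) (hq1 : (Cmod q < 1)%R)
  (hs : forall j : nat, (1 <= j)%nat -> Cpower q (s + INR j) <> 1) :
  exists delta : R, (0 < delta)%R /\
    forall t : C, (Cmod t < delta)%R ->
      qpoch_inf (t * Cpower q (s + 1)) q <> 0 /\
      (1 - t * z * Cpower q s) * qpoch_cplx t q (s + 1) <> 0 /\
      is_series (K := C_AbsRing) (V := C_NormedModule)
        (fun n : nat => qCesaro n s z q * t ^ n)
        (1 / ((1 - t * z * Cpower q s) * qpoch_cplx t q (s + 1))).
Proof.
  set (A := Cpower q (s + 1)); set (w := z * Cpower q s).
  assert (hA := Cmod_ge_0 A); assert (hw := Cmod_ge_0 w).
  (* Each of |t|, |A t| and |w t| is below 1 within this radius. *)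
  exists (/ (1 + Cmod A + Cmod w))%R; split.
  { apply Rinv_0_lt_compat; lra. }
  intros t ht.
  assert (ht0 := Cmod_ge_0 t).
  assert (hsum : (Cmod t + Cmod A * Cmod t + Cmod w * Cmod t < 1)%R).
  { apply Rmult_lt_compat_l with (r := (1 + Cmod A + Cmod w)%R) in ht; [|lra].
    rewrite Rinv_r in ht; lra. }
  assert (hAt0 := Rmult_le_pos _ _ hA ht0); assert (hwt0 := Rmult_le_pos _ _ hw ht0).
  assert (ht1 : (Cmod t < 1)%R) by lra.
  assert (hAt : (Cmod (A * t) < 1)%R) by (rewrite Cmod_mult; lra).
  assert (hwt : (Cmod (w * t) < 1)%R) by (rewrite Cmod_mult; lra).
  replace (t * A) with (A * t) by ring.
  replace (t * z * Cpower q s) with (w * t) by (unfold w; ring).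
  unfold qpoch_cplx; fold A; replace (t * A) with (A * t) by ring.
  destruct (qpoch_inf_correct t q hq1 ht1) as [_ h1].
  destruct (qpoch_inf_correct (A * t) q hq1 hAt) as [_ h2].
  assert (h3 := one_minus_neq_0 _ hwt).
  split; [exact h2|]; split.
  - apply Cmult_neq_0; [exact h3|].
    apply Cmult_neq_0; [exact h1 | now apply Cinv_neq_0].
  - replace (1 / ((1 - w * t) * (qpoch_inf t q / qpoch_inf (A * t) q)))
      with (qpoch_inf (A * t) q / qpoch_inf t q / (1 - w * t))
      by (field; repeat split; assumption).
    eapply is_series_ext;
      [|apply is_series_geom_convolution; [exact (qbinomial A q t hq1 ht1 hAt)|exact hwt]].
    intros n; rewrite qCesaro_conv by (assumption || split; assumption).
    fold A w.
    change Cmult with (@mult C_Ring) at 4.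
    rewrite <- (sum_n_mult_r (K := C_Ring)).
    apply sum_n_ext_loc; intros k hk.
    change (@mult C_Ring) with Cmult.
    rewrite Cpow_mult_l.
    assert (hn : t ^ n = t ^ (n - k) * t ^ k)
      by (rewrite <- Cpow_add_r; f_equal; lia).
    rewrite hn.
    match goal with |- ?x = ?y => change (@eq C x y) end; ring.
Qed.
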